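(* Let $P$ be any pattern with at least one $1$ entry, and let the pattern $P'$ be derived from $P$ by adding an empty column before the first column of $P$. Then for all positive integers $m$ and $n\ge 2$, $$\operatorname{sat}(m,n,P')= m+\operatorname{sat}(m,n-1,P).$$
   Context: All matrices are 0-1 matrices; a pattern is a 0-1 matrix. A column is empty if it contains no ones. A matrix $M$ contains $P$ if some submatrix of $M$ (obtained by deleting rows and columns) can be turned into $P$ by changing some number (possibly zero) of its ones to zeroes. The weight is the number of $1$ entries. $M$ is $P$-saturated if $M$ does not contain $P$, but changing any $0$ entry of $M$ to a $1$ yields a matrix containing $P$. $\operatorname{sat}(m,n,P)$ is the minimum weight of an $m\times n$ $P$-saturated matrix. *)

(* Defs.v *)
From mathcomp Require Import all_boot all_algebra.
Set Implicit Arguments.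
Unset Strict Implicit.
Unset Printing Implicit Defensive.

(* 0-1 matrices are boolean matrices, the entry [true] being a one. *)

Definition strictly_increasing (a b : nat) (f : {ffun 'I_a -> 'I_b}) : bool :=
  [forall i : 'I_a, forall j : 'I_a, (i < j) ==> (f i < f j)].

(* A submatrix obtained by deleting rows and columns is [mxsub f g M] for
   strictly increasing selections [f] of rows and [g] of columns; it can be
   turned into [P] by changing ones to zeroes iff it has a one wherever [P]
   has. *)
Definition contains (m n k l : nat) (M : 'M[bool]_(m, n))
    (P : 'M[bool]_(k, l)) : bool :=
  [exists f : {ffun 'I_k -> 'I_m}, exists g : {ffun 'I_l -> 'I_n},
    [&& strictly_increasing f, strictly_increasing g &
        [forall i : 'I_k, forall j : 'I_l, P i j ==> mxsub f g M i j]]].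

Definition set_one (m n : nat) (M : 'M[bool]_(m, n)) (i : 'I_m) (j : 'I_n) :
    'M[bool]_(m, n) :=
  \matrix_(a < m, b < n) (((a == i) && (b == j)) || M a b).

Definition weight (m n : nat) (M : 'M[bool]_(m, n)) : nat :=
  #|[set p : 'I_m * 'I_n | M p.1 p.2]|.

Definition saturated (m n k l : nat) (P : 'M[bool]_(k, l))
    (M : 'M[bool]_(m, n)) : bool :=
  ~~ contains M P &&
  [forall i : 'I_m, forall j : 'I_n, ~~ M i j ==> contains (set_one M i j) P].

(* The matrix [const_mx true] is a default value, returned only when there is
   no saturated matrix; by [satP] below this cannot happen if [P] has a one. *)
Definition sat (m n k l : nat) (P : 'M[bool]_(k, l)) : nat :=
  weight [arg min_(M < (const_mx true : 'M[bool]_(m, n)) | saturated P M)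
            weight M].

Definition add_empty_first_column (k l : nat) (P : 'M[bool]_(k, l)) :
    'M[bool]_(k, 1 + l) :=
  row_mx (const_mx false) P.

Lemma saturated_exists (m n k l : nat) (P : 'M[bool]_(k, l)) :
  (exists i j, P i j) -> exists M : 'M[bool]_(m, n), saturated P M.
Proof.
move=> [i0 [j0 Pij]].
have av0 : ~~ contains (const_mx false : 'M[bool]_(m, n)) P.
  apply/negP => /existsP[f /existsP[g /and3P[_ _ /forallP/(_ i0)/forallP/(_ j0)]]].
  by rewrite Pij !mxE.
have [M avM maxM] := @arg_maxnP _ _ (fun M : 'M[bool]_(m, n) => ~~ contains M P)
  (@weight m n) av0.
exists M; rewrite /saturated avM /=.
apply/forallP => i; apply/forallP => j; apply/implyP => Mij.
case: (boolP (contains _ _)) => // /maxM; rewrite /geq /= leqNgt => /negP[].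
apply/proper_card/properP; split.
  by apply/subsetP => p; rewrite !inE mxE => ->; rewrite orbT.
by exists (i, j); rewrite !inE ?mxE ?eqxx.
Qed.

Lemma satP (m n k l : nat) (P : 'M[bool]_(k, l)) :
  (exists i j, P i j) ->
  (exists2 M : 'M[bool]_(m, n), saturated P M & weight M = sat m n P) /\
  (forall M : 'M[bool]_(m, n), saturated P M -> sat m n P <= weight M).
Proof.
move=> /(saturated_exists m n)[M0 satM0].
rewrite /sat /arg_min /extremum; case: pickP => [M|noM] /=.
  case/andP=> satM /forallP minM; split; first by exists M.
  by move=> N /(implyP (minM N)).
have [M satM minM] := @arg_minnP _ _ (fun M : 'M[bool]_(m, n) => saturated P M)
  (@weight m n) satM0.
case/negP: (negbT (noM M)); rewrite /= satM /=.
by apply/forallP => N; apply/implyP => /minM.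
Qed.

(* Main.v *)
Require Import Defs.
From mathcomp Require Import all_boot all_algebra.

(** Write an [m x n] matrix, [n > 0], as [row_mx c N] with [c] its first column.
    The leading column of [P'] forces every later column of an occurrence of
    [P'] to lie in [N]; as that leading column is empty, it can always be placed
    on [c], whatever the entries of [c]. So [row_mx c N] contains [P'] iff [N]
    contains [P] ([contains_row_mx]). Turning a zero of [c] into a one
    therefore never creates an occurrence, and [row_mx c N] is [P']-saturated
    iff [c] is full of ones and [N] is [P]-saturated ([saturated_row_mx]).
    Prefixing a column of ones is thus a bijection from the [P]-saturated
    [m x (n - 1)] matrices to the [P']-saturated [m x n] ones, and it adds [m]
    to the weight; so the minima differ by [m]. *)

Lemma strictly_increasingP (a b : nat) (f : {ffun 'I_a -> 'I_b}) :
  reflect (forall i j : 'I_a, i < j -> f i < f j) (strictly_increasing f).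
Proof.
apply: (iffP forallP) => [incf i j | incf i].
  exact/implyP/(forallP (incf i)).
by apply/forallP => j; apply/implyP; apply: incf.
Qed.

Lemma containsP (m n k l : nat) (M : 'M[bool]_(m, n)) (P : 'M[bool]_(k, l)) :
  reflect (exists (f : {ffun 'I_k -> 'I_m}) (g : {ffun 'I_l -> 'I_n}),
             [/\ strictly_increasing f, strictly_increasing g
               & forall i j, P i j -> M (f i) (g j)])
          (contains M P).
Proof.
apply: (iffP existsP) => [[f /existsP[g /and3P[incf incg PM]]] |
                          [f [g [incf incg PM]]]]; exists f.
  exists g; split=> // i j Pij.
  by have := implyP (forallP (forallP PM i) j) Pij; rewrite mxE.
apply/existsP; exists g; rewrite incf incg /=.
by apply/forallP => i; apply/forallP => j; apply/implyP; rewrite mxE; apply: PM.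
Qed.

Lemma saturatedP (m n k l : nat) (P : 'M[bool]_(k, l)) (M : 'M[bool]_(m, n)) :
  reflect (~~ contains M P /\
           forall i j, ~~ M i j -> contains (set_one M i j) P)
          (saturated P M).
Proof.
apply: (iffP andP) => -[avM satM]; split=> //.
  by move=> i j; exact: (implyP (forallP (forallP satM i) j)).
by apply/forallP => i; apply/forallP => j; apply/implyP; apply: satM.
Qed.

Lemma set_one_lshift (m n1 n2 : nat) (A : 'M[bool]_(m, n1))
    (B : 'M[bool]_(m, n2)) (i : 'I_m) (j : 'I_n1) :
  set_one (row_mx A B) i (lshift n2 j) = row_mx (set_one A i j) B.
Proof.
apply/matrixP => a b; case: (split_ordP b) => b' ->.
  by rewrite mxE !row_mxEl mxE eq_lshift.
by rewrite mxE !row_mxEr eq_rlshift andbF.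
Qed.

Lemma set_one_rshift (m n1 n2 : nat) (A : 'M[bool]_(m, n1))
    (B : 'M[bool]_(m, n2)) (i : 'I_m) (j : 'I_n2) :
  set_one (row_mx A B) i (rshift n1 j) = row_mx A (set_one B i j).
Proof.
apply/matrixP => a b; case: (split_ordP b) => b' ->.
  by rewrite mxE !row_mxEl eq_lrshift andbF.
by rewrite mxE !row_mxEr mxE eq_rshift.
Qed.

Lemma weightE (m n : nat) (M : 'M[bool]_(m, n)) :
  weight M = \sum_i \sum_j M i j.
Proof.
rewrite pair_bigA /weight -sum1_card big_mkcond.
by apply: eq_bigr => p _; rewrite inE /=; case: (M _ _).
Qed.

Lemma weight_row_mx (m n1 n2 : nat) (A : 'M[bool]_(m, n1))
    (B : 'M[bool]_(m, n2)) :
  weight (row_mx A B) = weight A + weight B.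
Proof.
rewrite !weightE -big_split; apply: eq_bigr => i _ /=.
by rewrite big_split_ord; congr (_ + _); apply: eq_bigr => j _;
   rewrite ?row_mxEl ?row_mxEr.
Qed.

Lemma weight_const_true (m n : nat) :
  weight (const_mx true : 'M[bool]_(m, n)) = m * n.
Proof.
rewrite weightE (eq_bigr (fun=> n)) ?sum_nat_const ?card_ord // => i _.
by rewrite (eq_bigr (fun=> 1)) ?sum1_card ?card_ord // => j _; rewrite mxE.
Qed.

(** The entries of the first column are irrelevant: the leading column of the
    pattern occupies a column of the matrix but asks nothing of it. *)
Lemma contains_row_mx (m n k l : nat) (P : 'M[bool]_(k, l))
    (c : 'M[bool]_(m, 1)) (N : 'M[bool]_(m, n)) :
  contains (row_mx c N) (add_empty_first_column P) = contains N P.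
Proof.
apply/containsP/containsP => -[f [g [incf /strictly_increasingP incg PM]]].
  have g_gt0 j : 0 < g (rshift 1 j).
    exact: leq_ltn_trans (leq0n _) (incg (lshift l ord0) (rshift 1 j) isT).
  have g_lt j : (g (rshift 1 j)).-1 < n.
    by rewrite -ltnS prednK ?g_gt0 // ltn_ord.
  pose g' := [ffun j => Ordinal (g_lt j)].
  have g'E j : rshift 1 (g' j) = g (rshift 1 j).
    by apply: val_inj; rewrite /= ffunE /= add1n prednK.
  exists f, g'; split=> // [|i j Pij].
    apply/strictly_increasingP => i j lt_ij.
    rewrite -(ltn_add2l 1); have := incg (rshift 1 i) (rshift 1 j).
    by rewrite -!g'E /= ltn_add2l; apply.
  by rewrite -(row_mxEr c) g'E; apply: PM; rewrite row_mxEr.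
pose g' : {ffun 'I_(1 + l) -> 'I_(1 + n)} := [ffun j => match split j with
  | inl j0 => lshift n j0 | inr j0 => rshift 1 (g j0) end].
have g'l j : g' (lshift l j) = lshift n j.
  by rewrite ffunE -[lshift l j]/(unsplit (inl j)) unsplitK.
have g'r j : g' (rshift 1 j) = rshift 1 (g j).
  by rewrite ffunE -[rshift 1 j]/(unsplit (inr j)) unsplitK.
exists f, g'; split=> // [|i j].
  apply/strictly_increasingP => i j.
  case: (split_ordP i) => i' ->; case: (split_ordP j) => j' ->;
    rewrite ?g'l ?g'r ?[i']ord1 ?[j']ord1 //=.
  by rewrite !ltn_add2l; apply: incg.
case: (split_ordP j) => j' ->; first by rewrite row_mxEl mxE.
by rewrite row_mxEr g'r row_mxEr; apply: PM.
Qed.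

(** A zero in the first column would contradict saturation, because filling it
    leaves [N], and hence containment, unchanged. *)
Lemma saturated_row_mx (m n k l : nat) (P : 'M[bool]_(k, l))
    (c : 'M[bool]_(m, 1)) (N : 'M[bool]_(m, n)) :
  saturated (add_empty_first_column P) (row_mx c N) =
  (c == const_mx true) && saturated P N.
Proof.
apply/saturatedP/andP => [[] | [/eqP-> /saturatedP[avN satN]]].
  rewrite contains_row_mx => avN satM; split.
    apply/eqP/matrixP => i j; rewrite mxE; apply: contraNT avN => cij0.
    have := satM i (lshift n j).
    by rewrite set_one_lshift contains_row_mx row_mxEl; apply.
  apply/saturatedP; split=> // i j Nij0.
  have := satM i (rshift 1 j).
  by rewrite set_one_rshift contains_row_mx row_mxEr; apply.
rewrite contains_row_mx; split=> // i j.
case: (split_ordP j) => j' ->; first by rewrite row_mxEl mxE.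
by rewrite row_mxEr set_one_rshift contains_row_mx; apply: satN.
Qed.

Theorem corollary4p2 (k l : nat) (P : 'M[bool]_(k, l))
    (hP : exists (i : 'I_k) (j : 'I_l), P i j)
    (m n : nat) (hm : 0 < m) (hn : 2 <= n) :
  sat m n (add_empty_first_column P) = m + sat m (n - 1) P.
Proof.
have hP' : exists i j, add_empty_first_column P i j.
  by have [i [j Pij]] := hP; exists i, (rshift 1 j); rewrite row_mxEr.
have -> : n = 1 + (n - 1) by rewrite subnKC // ltnW.
rewrite addKn; move: (n - 1) => n'.
have [[M satM <-] minM] := satP m (1 + n') hP'.
have [[N satN <-] minN] := satP m n' hP.
have weight_ext N' : weight (row_mx (const_mx true : 'M_(m, 1)) N') =
    m + weight (N' : 'M[bool]_(m, n')).
  by rewrite weight_row_mx weight_const_true muln1.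
apply/eqP; rewrite eqn_leq; apply/andP; split.
  by rewrite -weight_ext; apply: minM; rewrite saturated_row_mx eqxx.
move: satM; rewrite -[M]hsubmxK saturated_row_mx => /andP[/eqP-> satN'].
by rewrite weight_ext leq_add2l minN.
Qed.
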